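(* For every integer $n\ge1$, the random variable $X_n$ has expected value $\mu_n:=\mathbb{E}(X_n)$ and variance $\sigma_n^2:=\mathbb{V}(X_n)$ given by $$\mu_n=\frac{2}{5}\left(\frac{F_{2n+1}}{F_{2n}}-\frac12+\frac1n\right)n,$$ $$\sigma_n^2=\frac{4}{25}\left(\frac{F_{2n+1}}{F_{2n}}-\frac12-\frac{n}{F_{2n}^2}-\frac{1}{2n}\right)n.$$
   Context: The polynomials $Q_n(x)$ are defined by $Q_0(x)=1$ and $Q_n(x)=x\sum_{k=1}^n k\,Q_{n-k}(x)$ for $n\ge 1$. The numbers $A_{n,k}$ are their coefficients: $Q_n(x)=\sum_{k=0}^n A_{n,k}x^k$. For $n\ge1$ and $0\le k\le n$ one has $A_{n,k}=\binom{n+k-1}{2k-1}$, with $A_{n,0}=0$. For $n\ge1$, $X_n$ is a random variable with values in $\{0,1,\dots,n\}$ and $P(X_n=k)=A_{n,k}/\sum_{m=0}^n A_{n,m}$. $F_n$ denotes the Fibonacci numbers, $F_0=0$, $F_1=1$, $F_n=F_{n-1}+F_{n-2}$. *)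

(* Defs.v *)
From HB Require Import structures.
From mathcomp Require Import all_boot all_order all_algebra.
From mathcomp Require Import all_classical all_reals all_analysis.

Set Implicit Arguments.
Unset Strict Implicit.
Unset Printing Implicit Defensive.

Import Order.TTheory GRing.Theory Num.Theory.
Local Open Scope ring_scope.

(* Q_n is defined from all of Q_0, ..., Q_(n-1), so the recursion is carried
   out on the sequence [:: Q_0; ...; Q_n]; see Q0 and QE for the recurrence. *)
Fixpoint Qseq (n : nat) : seq {poly int} :=
  if n is m.+1 then
    rcons (Qseq m) ('X * \sum_(1 <= k < n.+1) k%:R * (Qseq m)`_(n - k))
  else [:: 1].

Definition Q (n : nat) : {poly int} := (Qseq n)`_n.

Definition A (n k : nat) : int := (Q n)`_k.

Fixpoint fib (n : nat) : nat :=
  match n with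
  | 0 => 0
  | 1 => 1
  | (m.+1 as p).+1 => fib p + fib m
  end%N.

Lemma size_Qseq n : size (Qseq n) = n.+1.
Proof. by elim: n => //= n IHn; rewrite size_rcons IHn. Qed.

Lemma nth_Qseq n i : (i <= n)%N -> (Qseq n)`_i = Q i.
Proof.
elim: n => [|n IHn]; first by rewrite leqn0 => /eqP ->.
rewrite leq_eqVlt => /predU1P[-> //|]; rewrite ltnS => le_in.
by rewrite /= nth_rcons size_Qseq ltnS le_in IHn.
Qed.

Lemma Q0 : Q 0 = 1.
Proof. by []. Qed.

Lemma QE n : (0 < n)%N ->
  Q n = 'X * \sum_(1 <= k < n.+1) k%:R * Q (n - k).
Proof.
case: n => // n _; rewrite {1}/Q [Qseq n.+1]/= nth_rcons size_Qseq ltnn eqxx.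
congr (_ * _); apply: eq_big_nat => k /andP[k_gt0 _].
by rewrite nth_Qseq // leq_subLR -(prednK k_gt0) addSn ltnS leq_addl.
Qed.

(* Main.v *)
Require Import Defs.
From HB Require Import structures.
From mathcomp Require Import all_boot all_order all_algebra.
From mathcomp Require Import all_classical all_reals all_analysis.
From mathcomp Require Import measurable_realfun ring lra.
Import Order.TTheory GRing.Theory Num.Theory.
Local Open Scope classical_set_scope.
Local Open Scope ring_scope.

(** The Euler operator 'X * d/d'X multiplies the coefficient of 'X^k by k, so
    the sums over k of k ^+ j * A n k are the values at 1 of the iterates of
    this operator on Q n.  The mean and variance need j = 0, 1, 2 only.

    Differencing the defining convolution twice gives the three-term recurrence
    Q (n+2) = (2 + 'X) * Q (n+1) - Q n for n > 0 ([Q_recurrence]).  Applying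
    the Euler operator at most twice and evaluating at 1 turns it into linear
    recurrences for the three power sums; the first is that of F_(2n), namely
    u (n+2) = 3 u (n+1) - u n, and the other two are the same recurrence with
    the lower power sums as forcing terms.  Hence with a = F_(2n) and
    b = F_(2n+1) the three sums S_0, S_1, S_2 satisfy ([Q_moments])
      S_0 = a,
      5 S_1 = n (2b - a) + 2a,
      25 S_2 = 5 n^2 a + 6 n (2b - a) + 2a.
    The mean is S_1 / S_0.  The variance is S_2 / S_0 - (S_1 / S_0)^2, and
    25 times it contains - 4 n^2 (b^2 - a b - a^2) / a^2; Cassini's identity
    b^2 - a b - a^2 = 1 ([fib_double_Cassini]) reduces it to the
    isolated term n / F_(2n)^2 of the formula.

    On the probability side, a random variable with values in 0, ..., n is a
    finite combination of indicators, so the expectation of a nonnegative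
    function of it is a finite sum ([expectation_comp_nat]).  The variance is
    treated as the expectation of the nonnegative (X - mu)^2, so no
    integrability has to be established. *)

(** * Fibonacci numbers at even and odd indices *)

Lemma fib_gt0 n : (0 < fib n.+1)%N.
Proof. by elim: n => // n IHn; rewrite /= addn_gt0 -/(fib n.+1) IHn. Qed.

Lemma fib_double_succ n :
  (fib (2 * n.+1) = fib (2 * n + 1) + fib (2 * n))%N.
Proof. by rewrite mulnS add2n addn1. Qed.

Lemma fib_double_succ1 n :
  (fib (2 * n.+1 + 1) = fib (2 * n + 1) + fib (2 * n) + fib (2 * n + 1))%N.
Proof. by rewrite mulnS add2n !addn1. Qed.

Lemma fib_double_Cassini n :
  (fib (2 * n + 1))%:Z ^+ 2
    = (fib (2 * n))%:Z ^+ 2 + (fib (2 * n))%:Z * (fib (2 * n + 1))%:Z + 1.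
Proof.
elim: n => [//|n IHn]; rewrite fib_double_succ1 fib_double_succ !PoszD.
by ring: IHn.
Qed.

(** * The three-term recurrence *)

Lemma Q_convolution n : Q n.+1 = 'X * \sum_(k < n.+1) (n.+1 - k)%:R * Q k.
Proof.
rewrite QE // big_add1 /= big_mkord (reindex_inj rev_ord_inj) /=.
congr (_ * _); apply: eq_bigr => k _.
have k_le := leq_ord k; by rewrite !subSS (subSn k_le) subKn.
Qed.

(** First difference of the convolution: the weight of Q k drops from
    n + 2 - k to n + 1 - k, leaving a plain sum. *)
Lemma Q_succ n : Q n.+2 = Q n.+1 + 'X * \sum_(k < n.+2) Q k.
Proof.
rewrite !Q_convolution -mulrDr big_ord_recr /= subSnn mul1r; congr (_ * _).
rewrite [X in _ = _ + X]big_ord_recr addrA /=; congr (_ + _).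
rewrite -big_split; apply: eq_bigr => k _ /=.
by rewrite subSn 1?ltnW ?ltn_ord // -natr1 mulrDl mul1r.
Qed.

(** Second difference: the plain sum telescopes to its last term. *)
Lemma Q_recurrence n : Q n.+3 = (2 + 'X) * Q n.+2 - Q n.+1.
Proof.
rewrite Q_succ big_ord_recr /= mulrDr addrA.
have -> : 'X * \sum_(i < n.+2) Q i = Q n.+2 - Q n.+1 by rewrite Q_succ; ring.
by ring.
Qed.

(** The recurrence fails at n = 0 for the true value Q 0 = 1, but holds there
    once Q 0 is replaced by 0.  Starting the induction from this fictitious
    value makes both base cases trivial. *)
Lemma Q_pair_ind (S : nat -> {poly int} -> Prop) :
  S 0%N 0 -> S 1%N 'X ->
  (forall n p q, S n p -> S n.+1 q -> S n.+2 ((2 + 'X) * q - p)) ->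
  forall n, (0 < n)%N -> S n (Q n).
Proof.
move=> S0 S1 S2 [//|n] _.
have Q1 : Q 1 = 'X by rewrite QE // big_nat1 Q0 !mul1r mulr1.
have Q2 : Q 2 = (2 + 'X) * 'X - 0.
  by rewrite Q_succ !big_ord_recr big_ord0 /= Q0 Q1; ring.
suff [] : S n.+1 (Q n.+1) /\ S n.+2 (Q n.+2) by [].
elim: n => [|n [IH1 IH2]]; first by rewrite Q2 Q1; split=> //; apply: S2.
by split=> //; rewrite Q_recurrence; apply: S2.
Qed.

Lemma size_Q n : (0 < n)%N -> (size (Q n) <= n.+1)%N.
Proof.
move: n.
apply: (Q_pair_ind (fun n p => size p <= n.+1)%N) => [||n p q p_le q_le].
- by rewrite size_poly0.
- by rewrite size_polyX.
apply/leq_sizeP => j lt_nj.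
have q0 i : (n.+1 < i)%N -> q`_i = 0.
  by move=> lt_ni; rewrite (leq_sizeP _ _ q_le).
rewrite coefB mulrDl coefD mulr_natl coefMn coefXM.
rewrite (leq_sizeP _ _ p_le) ?(ltnW (ltnW lt_nj)) // q0 1?ltnW //.
by case: j lt_nj => //= j lt_nj; rewrite q0 // mul0rn addr0 subr0.
Qed.

(** * Power sums of coefficients *)

Definition euler {R : comNzRingType} (p : {poly R}) : {poly R} := 'X * p^`().

Section Euler.

Context {R : comNzRingType}.
Implicit Types p q : {poly R}.

Lemma coef_euler p k : (euler p)`_k = p`_k *+ k.
Proof. by rewrite coefXM coef_deriv; case: k. Qed.

Lemma coef_iter_euler j p k : (iter j euler p)`_k = p`_k * k%:R ^+ j.
Proof.
elim: j => [|j IHj]; first by rewrite mulr1.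
by rewrite iterS coef_euler IHj exprSr mulrA mulr_natr.
Qed.

Lemma horner1_iter_euler j p n : (size p <= n)%N ->
  (iter j euler p).[1] = \sum_(k < n) p`_k * k%:R ^+ j.
Proof.
move=> p_le; rewrite (@horner_coef_wide _ n); last first.
  apply/leq_sizeP => k le_nk.
  by rewrite coef_iter_euler (leq_sizeP _ _ p_le) ?mul0r.
by apply: eq_bigr => k _; rewrite expr1n mulr1 coef_iter_euler.
Qed.

Lemma eulerB p q : euler (p - q) = euler p - euler q.
Proof. by rewrite /euler derivB mulrBr. Qed.

Lemma eulerD p q : euler (p + q) = euler p + euler q.
Proof. by rewrite /euler derivD mulrDr. Qed.

Lemma eulerM p q : euler (p * q) = euler p * q + p * euler q.
Proof. by rewrite /euler derivM; ring. Qed.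

Lemma eulerX : euler 'X = 'X :> {poly R}.
Proof. by rewrite /euler derivX mulr1. Qed.

Lemma euler_two : euler (2 : {poly R}) = 0.
Proof. by rewrite /euler -polyC_natr derivC mulr0. Qed.

Lemma euler_step p q :
  euler ((2 + 'X) * q - p) = (2 + 'X) * euler q + 'X * q - euler p.
Proof. by rewrite eulerB eulerM eulerD euler_two eulerX; ring. Qed.

Lemma euler2_step p q :
  euler (euler ((2 + 'X) * q - p)) =
  (2 + 'X) * euler (euler q) + 2 * ('X * euler q) + 'X * q - euler (euler p).
Proof.
by rewrite euler_step eulerB eulerD !eulerM eulerD euler_two eulerX; ring.
Qed.

End Euler.

(** Closed forms for the power sums of orders 0, 1 and 2 of the coefficients
    of p, as they hold for p = Q n.  They are also correct for n = 0 and p = 0,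
    the fictitious start of [Q_pair_ind]. *)
Definition fib_moments (n : nat) (p : {poly int}) : Prop :=
  let a := (fib (2 * n))%:Z in let b := (fib (2 * n + 1))%:Z in
  [/\ p.[1] = a,
      5 * (euler p).[1] = n%:Z * (2 * b - a) + 2 * a &
      25 * (euler (euler p)).[1]
        = 5 * n%:Z ^+ 2 * a + 6 * n%:Z * (2 * b - a) + 2 * a].

(** Both sides satisfy the same linear recurrences: at 1 the factor 2 + 'X
    is 3, and [euler_step] and [euler2_step] give the forcing terms. *)
Lemma Q_moments n : (0 < n)%N -> fib_moments n (Q n).
Proof.
have euler0 : euler (0 : {poly int}) = 0 by rewrite /euler deriv0 mulr0.
have one1 : (1 : {poly int}).[1] = 1 by rewrite hornerC.
move: n; apply: (Q_pair_ind fib_moments) => [||n p q].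
- by split; rewrite ?euler0 horner0.
- by split; rewrite ?eulerX hornerX.
rewrite /fib_moments; lazy zeta.
rewrite !fib_double_succ1 !fib_double_succ !fib_double_succ1 !PoszD.
rewrite (intS n.+1) (intS n) euler2_step euler_step.
(* With the Fibonacci numbers and the iterates of the operator as unknowns,
   each equation is a linear consequence of the hypotheses. *)
move: (fib _)%:Z (fib _)%:Z => a b.
move: (euler q) (euler (euler q)) (euler p) (euler (euler p)).
move=> q' q'' p' p'' [p0 p1 p2] [q0 q1 q2].
rewrite !(hornerD, hornerN, hornerM, hornerX, one1).
split; lra.
Qed.

Lemma sum_A_moment (R : realType) j n : (0 < n)%N ->
  \sum_(0 <= k < n.+1) k%:R ^+ j * (A n k)%:~R
    = ((iter j euler (Q n)).[1])%:~R :> R.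
Proof.
move=> n_gt0; rewrite (horner1_iter_euler _ _ _ (size_Q _ n_gt0)).
rewrite big_mkord rmorph_sum /=.
by apply: eq_bigr => k _; rewrite intrM mulrC rmorphXn /= mulrz_nat.
Qed.

(** * Expectations of random variables with finitely many natural values *)

(** Nonnegativity of g on the values makes additivity of the integral
    available without any integrability condition. *)
Lemma expectation_comp_nat (R : realType) (d : measure_display)
    (T : measurableType d) (P : probability T R) (n : nat)
    (X : {RV P >-> R}) (p : nat -> R) (g : R -> R) :
  (forall w, exists2 k : nat, (k <= n)%N & X w = k%:R) ->
  (forall k, (k <= n)%N -> P (X @^-1` [set k%:R]) = (p k)%:E) ->
  (forall k : nat, 0 <= g k%:R) ->
  'E_P[g \o X]%E = (\sum_(0 <= k < n.+1) g k%:R * p k)%:E.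
Proof.
move=> X_le X_law g_ge0; rewrite unlock.
pose E k := X @^-1` [set k%:R : R].
have mE k : measurable (E k) by apply: measurable_funPTI.
pose f k w := ((g k%:R)%:E * (\1_(E k) w)%:E)%E.
have gXf w : ((g \o X) w)%:E = (\sum_(0 <= k < n.+1) f k w)%E.
  have [k k_le Xw] := X_le w.
  rewrite (bigD1_seq k) ?mem_index_iota ?iota_uniq //= big1 => [|i /negPf i_k].
    by rewrite adde0 /f indicE mem_set // mule1 Xw.
  rewrite /f indicE memNset ?mule0 // /E /= Xw => /eqP.
  by rewrite eqr_nat eq_sym i_k.
under eq_integral do rewrite gXf.
rewrite ge0_integral_sum //=; first last.
- by move=> k w _; rewrite mule_ge0 ?lee_fin.
- by move=> k; exact/measurable_EFinP/measurable_funM.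
rewrite -sumEFin !big_nat; apply: eq_bigr => k /andP[_ k_le].
rewrite ge0_integralZl_EFin //=.
  by rewrite integral_indic // setIT /E EFinM -(X_law k k_le).
exact/measurable_EFinP.
Qed.

(** * Mean and variance *)

Theorem proposition1p4 (R : realType) (d : measure_display)
    (T : measurableType d) (P : probability T R) (n : nat) (hn : (1 <= n)%N)
    (X : {RV P >-> R})
    (X_values : forall w : T, exists2 k : nat, (k <= n)%N & X w = k%:R)
    (X_law : forall k : nat, (k <= n)%N ->
       P (X @^-1` [set k%:R]) =
         ((A n k)%:~R / (\sum_(0 <= m < n.+1) A n m)%:~R)%:E) :
  'E_P[X]%E =
    (2 / 5 * ((fib (2 * n + 1))%:R / (fib (2 * n))%:R - 1 / 2 + 1 / n%:R)
       * n%:R)%:E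
  /\
  'V_P[X]%E =
    (4 / 25 * ((fib (2 * n + 1))%:R / (fib (2 * n))%:R - 1 / 2
                - n%:R / (fib (2 * n))%:R ^+ 2 - 1 / (2 * n%:R))
       * n%:R)%:E.
Proof.
have [s0 s1 s2] := Q_moments n hn.
have cassini := fib_double_Cassini n.
have a_gt0 : (0 < fib (2 * n))%N by rewrite -(prednK hn) mulnS fib_gt0.
set a : R := (fib (2 * n))%:R; set b : R := (fib (2 * n + 1))%:R.
have a_neq0 : a != 0 by rewrite pnatr_eq0 -lt0n.
have n_neq0 : n%:R != 0 :> R by rewrite pnatr_eq0 -lt0n.
pose M j : R := \sum_(0 <= k < n.+1) k%:R ^+ j * (A n k)%:~R.
have M0 : M 0%N = a by rewrite /M (sum_A_moment R 0 n hn) s0.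
have M1 : M 1%N = (n%:R * (2 * b - a) + 2 * a) / 5.
  have /(congr1 (fun z : int => z%:~R : R)) := s1.
  rewrite /M (sum_A_moment R 1 n hn) !(intrM, intrD, rmorphB) /= => e; lra.
have M2 : M 2%N
    = (5 * n%:R ^+ 2 * a + 6 * n%:R * (2 * b - a) + 2 * a) / 25.
  have /(congr1 (fun z : int => z%:~R : R)) := s2.
  rewrite /M (sum_A_moment R 2 n hn) !(intrM, intrD, rmorphB) /= => e; lra.
have cassiniR : b ^+ 2 = a ^+ 2 + a * b + 1.
  have /(congr1 (fun z : int => z%:~R : R)) := cassini.
  by rewrite !(intrM, intrD, rmorphXn).
have sumA : (\sum_(0 <= m < n.+1) A n m)%:~R = a.
  rewrite -M0 /M rmorph_sum /=.
  by apply: eq_bigr => k _; rewrite mul1r.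
have mean : 'E_P[X]%E = (M 1%N / a)%:E.
  rewrite (expectation_comp_nat _ _ _ _ _ X _ id X_values X_law) //.
  rewrite sumA /M mulr_suml; congr (_%:E).
  by apply: eq_bigr => k _; rewrite mulrA.
pose mu := M 1%N / a.
have var : 'V_P[X]%E = ((M 2%N - 2 * mu * M 1%N + mu ^+ 2 * M 0%N) / a)%:E.
  rewrite /variance unlock mean /=.
  rewrite -[LHS]/('E_P[((fun x : R => (x - mu) ^+ 2) \o X)%R])%E.
  rewrite (expectation_comp_nat _ _ _ _ _ X _ _ X_values X_law) => [|k].
    congr (_%:E); rewrite sumA /M !mulr_sumr -sumrB -big_split mulr_suml /=.
    by apply: eq_bigr => k _; ring.
  by rewrite sqr_ge0.
split; first by rewrite mean M1; congr (_%:E); field; rewrite a_neq0 n_neq0.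
rewrite var /mu M0 M1 M2; congr (_%:E).
(* Homogenizing n / a^2 by Cassini's identity makes the claim a formal
   identity in a, b and n. *)
have -> : n%:R / a ^+ 2 = (n%:R * (b ^+ 2 - a * b - a ^+ 2)) / a ^+ 2.
  have <- : 1 = b ^+ 2 - a * b - a ^+ 2 by rewrite cassiniR; ring.
  by rewrite mulr1.
by field; rewrite a_neq0 n_neq0.
Qed.
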